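(* Let $V$ be a finite-dimensional real vector space with a positive definite symmetric bilinear form $\langle\,,\rangle$, let $M\subset V$ be a lattice, and let $W\subset \mathrm{GL}(V)$ be a finite reflection group preserving $M$. Let $D$ be the fundamental domain of $W$ associated to a simple system $\Delta$ of $W$. If $S\subset M$ is a saturated affine semigroup with $w(S)=S$ for all $w\in W$, then there is a ring isomorphism $\mathbb{Z}[D\cap S]\to \mathbb{Z}[S]^W$. Equivalently, the quotient $\operatorname{Spec}\mathbb{Z}[S]/W=\operatorname{Spec}(\mathbb{Z}[S]^W)$ is isomorphic to the normal affine toric variety $\operatorname{Spec}\mathbb{Z}[D\cap S]$.
   Context: A lattice in $V$ is the $\mathbb{Z}$-span of a basis of $V$. For nonzero $\alpha\in V$, the reflection $s_\alpha$ is $s_\alpha(v)=v-2\frac{\langle v,\alpha\rangle}{\langle\alpha,\alpha\rangle}\alpha$; a (finite) reflection group is a finite subgroup of $\mathrm{GL}(V)$ generated by such reflections. A root system is a finite set $\Phi\subset V$ such that for all $\alpha\in\Phi$, $\Phi\cap\mathbb{R}\alpha=\{\alpha,-\alpha\}$ and $s_\alpha(\Phi)=\Phi$; every finite reflection group $W$ is generated by $\{s_\alpha:\alpha\in\Phi\}$ for some root system $\Phi$. A simple system is a linearly independent subset $\Delta=\{\alpha_1,\dots,\alpha_r\}\subset\Phi$ spanning the same subspace as $\Phi$ such that every element of $\Phi$ is a real linear combination of elements of $\Delta$ with coefficients all of the same sign. The associated fundamental domain is $D=\{v\in V:\langle v,\alpha_i\rangle\ge 0,\ 1\le i\le r\}$.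 A saturated affine semigroup is a finitely generated $\mathbb{Z}_{\ge0}$-submodule $S\subset M$ such that for all $k\in\mathbb{Z}_{>0}$ and $m\in M$, $km\in S$ implies $m\in S$. For a semigroup $S$, $\mathbb{Z}[S]$ is the semigroup ring with $\mathbb{Z}$-basis $\{\chi^s:s\in S\}$ and $\chi^s\chi^t=\chi^{s+t}$; $W$ acts on $\mathbb{Z}[S]$ by $w\chi^s=\chi^{ws}$, and $\mathbb{Z}[S]^W$ denotes the invariants. *)

(* Defs.v *)
From HB Require Import structures.
From mathcomp Require Import all_boot all_order all_algebra.
From mathcomp Require Import finmap.
From mathcomp Require Import reals.

Set Implicit Arguments.
Unset Strict Implicit.
Unset Printing Implicit Defensive.

Import Order.TTheory GRing.Theory Num.Theory.
Local Open Scope ring_scope.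

Section Defs.
Context {R : realType} {n : nat}.
Local Notation V := 'rV[R]_n.

Definition ip (B : 'M[R]_n) (u v : V) : R := (u *m B *m v^T) 0 0.

Definition posdef_sym (B : 'M[R]_n) : Prop :=
  B^T = B /\ forall v : V, v != 0 -> 0 < ip B v v.

Definition is_lattice (M : V -> Prop) : Prop :=
  exists L : 'M[R]_n, L \in unitmx /\
    forall v : V, M v <-> exists z : 'rV[int]_n, v = map_mx intr z *m L.

(* The reflection s_a(v) = v - 2 <v,a>/<a,a> a, and its matrix
   (linear maps act on row vectors on the right: v |-> v *m g). *)
Definition reflmap (B : 'M[R]_n) (a : V) (v : V) : V :=
  v - (2 * ip B v a / ip B a a) *: a.
Definition refl_mx (B : 'M[R]_n) (a : V) : 'M[R]_n := lin1_mx (reflmap B a).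

Definition maps_onto (g : 'M[R]_n) (A : V -> Prop) : Prop :=
  (forall x, A x -> A (x *m g)) /\ (forall y, A y -> exists x, A x /\ y = x *m g).

Definition finite_subgroup_GL (W : seq 'M[R]_n) : Prop :=
  [/\ 1%:M \in W,
      forall g, g \in W -> g \in unitmx,
      forall g h, g \in W -> h \in W -> g *m h \in W &
      forall g, g \in W -> invmx g \in W].

Definition generated_by (B : 'M[R]_n) (W : seq 'M[R]_n) (X : seq V) : Prop :=
  (forall a, a \in X -> refl_mx B a \in W) /\
  (forall w, w \in W -> exists l : seq V,
       {subset l <= X} /\ w = foldr (fun a g => refl_mx B a *m g) 1%:M l).

Definition finite_reflection_group (B : 'M[R]_n) (W : seq 'M[R]_n) : Prop :=
  finite_subgroup_GL W /\
  exists X : seq V, (forall a, a \in X -> a != 0) /\ generated_by B W X.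

Definition root_system (B : 'M[R]_n) (Phi : seq V) : Prop :=
  forall a, a \in Phi ->
    [/\ a != 0,
        (forall c : R, c *: a \in Phi <-> (c = 1 \/ c = -1)) &
        forall b, b \in Phi -> reflmap B a b \in Phi].

Definition simple_system (Phi Delta : seq V) : Prop :=
  [/\ {subset Delta <= Phi},
      free Delta,
      (<<Delta>> = <<Phi>>)%VS &
      forall b, b \in Phi -> exists c : 'I_(size Delta) -> R,
        b = \sum_(i < size Delta) c i *: Delta`_i /\
        ((forall i, 0 <= c i) \/ (forall i, c i <= 0))].

Definition fund_domain (B : 'M[R]_n) (Delta : seq V) (v : V) : Prop :=
  forall a, a \in Delta -> 0 <= ip B v a.

Definition saturated_affine_semigroup (M S : V -> Prop) : Prop :=
  [/\ forall v, S v -> M v,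
      (exists gens : seq V, forall v, S v <->
        exists k : 'I_(size gens) -> nat, v = \sum_(i < size gens) (k i)%:R *: gens`_i) &
      forall (k : nat) (m : V), (0 < k)%N -> M m -> S (k%:R *: m) -> S m].

(* The group ring Z[V]; Z[A] for A a subset of V is the set of elements
   supported in A, with the convolution product chi^s chi^t = chi^(s+t). *)
Definition Zring := {fsfun V -> int for fun => 0}.

Definition gadd (f g : Zring) : Zring :=
  [fsfun v in (finsupp f `|` finsupp g)%fset => f v + g v].

Definition gmul (f g : Zring) : Zring :=
  [fsfun v in [fset (a + b)%R | a in finsupp f, b in finsupp g]%fset =>
     \sum_(a <- finsupp f) \sum_(b <- finsupp g | a + b == v) f a * g b].

Definition gone : Zring := [fsfun v in [fset (0 : V)]%fset => 1].

Definition supported_in (A : V -> Prop) (f : Zring) : Prop :=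
  forall v, f v != 0 -> A v.

(* W-invariance: w chi^s = chi^(ws). *)
Definition W_invariant (W : seq 'M[R]_n) (f : Zring) : Prop :=
  forall w, w \in W -> forall v : V, f (v *m w) = f v.

Definition ring_iso_between (P Q : Zring -> Prop) (phi : Zring -> Zring) : Prop :=
  [/\ forall f, P f -> Q (phi f),
      (forall f g, P f -> P g -> phi (gadd f g) = gadd (phi f) (phi g)) /\
      (forall f g, P f -> P g -> phi (gmul f g) = gmul (phi f) (phi g)) /\
      phi gone = gone,
      (forall f g, P f -> P g -> phi f = phi g -> f = g) &
      (forall h, Q h -> exists f, P f /\ phi f = h)].

End Defs.

(* Main.v *)
(* Scale each simple root to a vector [be i] generating the lattice points on its
   line. The coroot pairings are then integral on [M], and [M] contains every
   [be i]. With fundamental weights [om i] dual to the coroots, each [lam] in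
   [D] and [S] is [lam0 + sum_i k_i om_i] with [lam0] fixed by [W] and [k_i]
   natural; let [phi] send [chi^lam] to [chi^lam0 * prod_i x_i^k_i], where [x_i]
   is the orbit sum of [om i], an element of Z[V] even when [om i] is not in [M].
   This is multiplicative, its values are invariant, and its leading term is
   [chi^lam] for the dominance order, so that [phi] is injective and, by
   cancelling leading terms, surjective. The image lies in Z[S]: each exponent is
   conjugate to a dominant [mu] with [lam - mu] a sum of scaled simple roots, and
   saturation allows one to go down from [lam] to [mu] inside [S] one scaled
   simple root at a time. *)

Require Import Defs.
From HB Require Import structures.
From mathcomp Require Import all_boot all_order all_algebra.
From mathcomp Require Import finmap.
From mathcomp Require Import reals.
From mathcomp Require boolp.
From mathcomp Require Import ring lra.
Set Implicit Arguments.
Unset Strict Implicit.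
Unset Printing Implicit Defensive.
Import Order.TTheory GRing.Theory Num.Theory.
Local Open Scope ring_scope.

(** * Forms and reflections *)

Section Form.
Context {R : realType} {n : nat} (B : 'M[R]_n) (posB : posdef_sym B).
Local Notation V := 'rV[R]_n.
Local Notation ip := (ip B).
Local Notation s := (reflmap B).

Lemma ipDl (u v w : V) : ip (u + v) w = ip u w + ip v w.
Proof. by rewrite /Defs.ip !mulmxDl mxE. Qed.

Lemma ipZl (c : R) (u w : V) : ip (c *: u) w = c * ip u w.
Proof. by rewrite /Defs.ip -!scalemxAl mxE. Qed.

Lemma ipC (u v : V) : ip u v = ip v u.
Proof.
transitivity ((v *m B *m u^T)^T 0 0); last by rewrite mxE.
by rewrite !trmx_mul trmxK (proj1 posB) mulmxA.
Qed.

Lemma ipNl (u w : V) : ip (- u) w = - ip u w.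
Proof. by rewrite -scaleN1r ipZl mulN1r. Qed.

Lemma ipBl (u v w : V) : ip (u - v) w = ip u w - ip v w.
Proof. by rewrite ipDl ipNl. Qed.

Lemma ip0l (w : V) : ip 0 w = 0.
Proof. by rewrite -(scale0r 0) ipZl mul0r. Qed.

Lemma ip_suml (I : Type) (l : seq I) (F : I -> V) (w : V) :
  ip (\sum_(i <- l) F i) w = \sum_(i <- l) ip (F i) w.
Proof. by apply: (big_morph (ip^~ w)) => [u v|]; rewrite ?ipDl ?ip0l. Qed.

Lemma ipZr (c : R) (u w : V) : ip w (c *: u) = c * ip w u.
Proof. by rewrite !(ipC w) ipZl. Qed.

Lemma ipBr (u v w : V) : ip w (u - v) = ip w u - ip w v.
Proof. by rewrite !(ipC w) ipBl. Qed.

Lemma ip_sumr (I : Type) (l : seq I) (F : I -> V) (w : V) :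
  ip w (\sum_(i <- l) F i) = \sum_(i <- l) ip w (F i).
Proof. by rewrite ipC ip_suml; apply: eq_bigr => i _; rewrite ipC. Qed.

Lemma ip_gt0 (v : V) : v != 0 -> 0 < ip v v.
Proof. by have [_] := posB; apply. Qed.

Fact reflmap_is_linear (a : V) : linear (s a).
Proof.
move=> c u v; rewrite /reflmap ipDl ipZl scalerBr addrACA -opprD scalerA.
by rewrite -scalerDl; congr (_ - _ *: _); ring.
Qed.

HB.instance Definition _ (a : V) :=
  GRing.isLinear.Build R V V *:%R (s a) (reflmap_is_linear a).

Lemma reflB (a u v : V) : s a (u - v) = s a u - s a v.
Proof. exact: linearB. Qed.

Lemma reflZr (a : V) (c : R) (v : V) : s a (c *: v) = c *: s a v.
Proof. exact: linearZ. Qed.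

Lemma mul_refl_mx (a v : V) : v *m refl_mx B a = s a v.
Proof. exact: mul_rV_lin1. Qed.

Lemma ip_refl (a u v : V) : ip (s a u) v = ip u (s a v).
Proof. by rewrite /reflmap ipBl ipBr ipZl ipZr (ipC a v); ring. Qed.

Lemma refl_self (a : V) : a != 0 -> s a a = - a.
Proof.
move=> /ip_gt0 /gt_eqF /negbT aa0.
by rewrite /reflmap mulfK // scaler_nat mulr2n opprD addrA subrr sub0r.
Qed.

Lemma reflK (a v : V) : a != 0 -> s a (s a v) = v.
Proof.
move=> a0; rewrite {2}/reflmap reflB reflZr refl_self // scalerN opprK.
by rewrite /reflmap subrK.
Qed.

Lemma refl_conj (a b v : V) : a != 0 -> s (s a b) (s a v) = s a (s b v).
Proof.
move=> a0; rewrite [LHS]/reflmap !ip_refl !reflK //.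
by rewrite [s b v]/reflmap reflB reflZr.
Qed.

Lemma reflZ (c : R) (a v : V) : c != 0 -> s (c *: a) v = s a v.
Proof.
move=> c0; rewrite /reflmap ipZl !ipZr scalerA; congr (_ - _ *: _).
(* The case [ip a a = 0] is harmless: division by zero yields 0 on both sides. *)
have [->|a0] := eqVneq (ip a a) 0; first by rewrite !(mulr0, invr0, mul0r).
by field; rewrite c0 a0.
Qed.

(** Positive definiteness makes the Gram matrix [G] of a free family invertible; the rows of
    [invmx G *m A] are then the dual family, inside the same span. *)
Lemma exists_dual (r : nat) (a : 'I_r -> V) :
  (forall c : 'I_r -> R, \sum_i c i *: a i = 0 -> forall i, c i = 0) ->
  exists d : 'I_r -> V, (forall i j, ip (a i) (d j) = (i == j)%:R) /\
    forall j, exists c : 'I_r -> R, d j = \sum_i c i *: a i.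
Proof.
move=> afree; pose A := \matrix_(i < r) a i; pose G := A *m B *m A^T.
have mulA (v : 'rV_r) : v *m A = \sum_i v 0 i *: a i.
  by rewrite mulmx_sum_row; apply: eq_bigr => i _; rewrite rowK.
have Gu : G \in unitmx.
  rewrite -row_free_unit; apply: inj_row_free => v vG0.
  have : ip (v *m A) (v *m A) = 0.
    by rewrite /Defs.ip trmx_mul !mulmxA -(mulmxA v) -(mulmxA v) vG0 mul0mx mxE.
  have [vA0 _|/ip_gt0 /gt_eqF /eqP//] := eqVneq (v *m A) 0.
  by apply/rowP => i; rewrite mxE; apply: (afree (v 0)); rewrite -mulA.
have GT : G^T = G by rewrite !trmx_mul trmxK (proj1 posB) mulmxA.
exists (fun j => row j (invmx G *m A)); split=> [i j|j]; last first.
  by exists (row j (invmx G) 0); rewrite row_mul mulA.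
have -> : a i = row i A by rewrite rowK.
have ->: ip (row i A) (row j (invmx G *m A)) = (A *m B *m (invmx G *m A)^T) i j.
  rewrite /Defs.ip -row_mul [LHS]mxE [RHS]mxE; apply: eq_bigr => k _.
  by congr (_ * _); [rewrite [LHS]mxE | rewrite [LHS]mxE [RHS]mxE [LHS]mxE].
by rewrite trmx_mul mulmxA trmx_inv GT mulmxV // mxE.
Qed.
End Form.

(** * Words in simple reflections *)

Lemma sub_count_lt (T : eqType) (a1 a2 : pred T) (x : T) (s : seq T) :
  x \in s -> subpred a1 a2 -> a2 x -> ~~ a1 x -> (count a1 s < count a2 s)%N.
Proof.
move=> /perm_to_rem /permP sE a12 a2x a1x; rewrite !sE /= a2x (negPf a1x) add0n.
by rewrite ltnS sub_count.
Qed.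

Definition word_act {R : realType} {n r : nat} (B : 'M[R]_n)
    (al : 'I_r -> 'rV[R]_n) (l : seq 'I_r) (v : 'rV[R]_n) :=
  foldl (fun u i => reflmap B (al i) u) v l.

Section SimpleRoots.
Context {R : realType} {n r : nat} (B : 'M[R]_n) (posB : posdef_sym B).
Local Notation V := 'rV[R]_n.
Local Notation ip := (ip B).
Local Notation s := (reflmap B).
Context (Phi : seq V) (al dl : 'I_r -> V).
Context (rootPhi : root_system B Phi) (alPhi : forall i, al i \in Phi).
Context (dual : forall i j, ip (al i) (dl j) = (i == j)%:R).
Context (coordE : forall b, b \in Phi -> b = \sum_j ip b (dl j) *: al j).
Context (signed : forall b, b \in Phi ->
  (forall j, 0 <= ip b (dl j)) \/ (forall j, ip b (dl j) <= 0)).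
Local Notation sr i := (s (al i)).
Local Notation act := (word_act B al).

(** As [dl] is dual to [al], the number [ip b (dl j)] is the coefficient of [al j] in a root [b]. *)
Definition positive (b : V) := forall j, 0 <= ip b (dl j).

Lemma root_neq0 (b : V) : b \in Phi -> b != 0.
Proof. by case/rootPhi. Qed.

Lemma root_refl (a b : V) : a \in Phi -> b \in Phi -> s a b \in Phi.
Proof. by case/rootPhi => _ _; apply. Qed.

Lemma rootN (b : V) : b \in Phi -> - b \in Phi.
Proof.
by move=> /rootPhi [_ Hc _]; rewrite -scaleN1r; apply/Hc; right.
Qed.

(** The reflection changes only the coordinate along [al i]. If the image were negative, the other
    coordinates of [b] would vanish, so [b] would be [al i] or its opposite; positivity excludes the
    latter. *)
Lemma refl_positive (b : V) (i : 'I_r) :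
  b \in Phi -> positive b -> b != al i -> positive (sr i b).
Proof.
move=> bP bpos bi; case: (signed (root_refl (alPhi i) bP)) => // neg.
suff b_al : b = ip b (dl i) *: al i.
  have [_ /(_ (ip b (dl i))) [Hc _] _] := rootPhi (alPhi i).
  have /Hc [c1|cN1] : ip b (dl i) *: al i \in Phi by rewrite -b_al.
    by rewrite b_al c1 scale1r eqxx in bi.
  by have := bpos i; rewrite cN1 oppr_ge0 ler10.
rewrite {1}(coordE bP) (bigD1 i) //= big1 ?addr0 // => j ji.
suff -> : ip b (dl j) = 0 by rewrite scale0r.
apply/eqP; rewrite eq_le bpos andbT.
by have := neg j; rewrite /reflmap ipBl ipZl dual eq_sym (negPf ji) mulr0 subr0.
Qed.

(* The deletion condition; words act from left to right, so [rev l] is the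
   inverse of [l]. *)
Lemma word_deletion (l : seq 'I_r) (b : V) :
  b \in Phi -> positive b -> ~ positive (act l b) ->
  exists l1, (size l1 < size l)%N /\
    forall v, s b (act (rev l) v) = act l1 v.
Proof.
elim: l b => [//|i l IH] b bP bpos /= nact.
have i0 := root_neq0 (alPhi i).
have actE v : act (rev (i :: l)) v = sr i (act (rev l) v).
  by rewrite rev_cons -cats1 /word_act foldl_cat.
have [b_i|b_i] := eqVneq b (al i).
  by exists (rev l); rewrite size_rev; split=> // v; rewrite actE b_i reflK.
have [||l1 [szl1 Hl1]] := IH (sr i b) _ _ nact.
- exact: root_refl.
- exact: refl_positive.
(* The identity [s_b s_i = s_i s_c] with [c = sr i b] moves the reflection past the letter [i],
   where the inductive hypothesis applies. *)
exists (rcons l1 i); rewrite size_rcons ltnS; split=> // v.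
rewrite actE -cats1 /word_act foldl_cat /= -/(act l1 v).
by rewrite -Hl1 -[RHS](refl_conj posB) // reflK.
Qed.

(** Expanding [ip b b > 0] along the simple roots gives a positive term, whose coefficient is
    nonnegative. *)
Lemma sum_dual (b : V) : b \in Phi -> positive b ->
  exists2 i, 0 < ip b (dl i) & 0 < ip b (al i).
Proof.
move=> bP bpos; have := ip_gt0 posB (root_neq0 bP).
rewrite {2}(coordE bP) ip_sumr //; under eq_bigr do rewrite ipZr //.
move=> sum_gt0.
have [i _ Hi] : exists2 i, true & 0 < ip b (dl i) * ip b (al i).
  apply/exists_inP; rewrite -[X in is_true X]negbK negb_exists_in.
  apply/negP => /forall_inP Hle.
  move: sum_gt0; rewrite ltNge sumr_le0 // => i _; by rewrite leNgt Hle.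
have di0 : 0 < ip b (dl i).
  by rewrite lt_neqAle bpos andbT; apply: contraTneq Hi => <-; rewrite mul0r ltxx.
by exists i => //; rewrite -(pmulr_rgt0 _ di0).
Qed.

(** A simple reflection that lowers [b] conjugates [s b] to the reflection in a lower positive root;
    the descent ends at a simple root. *)
Lemma refl_simple_word (b : V) : b \in Phi ->
  exists l, forall v, s b v = act l v.
Proof.
move=> bP0.
wlog bpos0 : b bP0 / positive b.
  move=> Hw; case: (signed bP0) => [|neg]; first exact: Hw.
  have [||l Hl] := Hw (- b); first exact: rootN.
    by move=> j; rewrite ipNl oppr_ge0.
  exists l => v; rewrite -Hl -scaleN1r reflZ //.
  by rewrite oppr_eq0 oner_eq0.
pose ht b := ip b (\sum_j dl j).
have htE x i : ht (sr i x) = ht x - 2 * ip x (al i) / ip (al i) (al i).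
  suff ht1 : ip (al i) (\sum_j dl j) = 1 by rewrite /ht /reflmap ipBl ipZl ht1 mulr1.
  rewrite ip_sumr // (bigD1 i) //= dual eqxx big1 ?addr0 // => j ji.
  by rewrite dual eq_sym (negPf ji).
(* Heights are real numbers, so the induction runs on the number of roots lower than [b]. *)
have [N] := ubnP (count (fun x => ht x < ht b) Phi).
elim: N b bP0 bpos0 => // N IH b bP bpos; rewrite ltnS => cntN.
have [i di bi] := sum_dual bP bpos.
have i0 := root_neq0 (alPhi i).
have [b_i|b_i] := eqVneq b (al i); first by exists [:: i] => v; rewrite b_i.
have lt_ht : ht (sr i b) < ht b.
  by rewrite htE ltrBlDr ltrDl divr_gt0 ?mulr_gt0 ?ip_gt0.
have sbP := root_refl (alPhi i) bP.
have [||l Hl] := IH (sr i b) sbP; first exact: refl_positive.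
  apply: leq_trans cntN; apply: (sub_count_lt sbP) => //=; last by rewrite ltxx.
  by move=> x /= /lt_trans; apply.
exists (i :: rcons l i) => v.
rewrite -cats1 /word_act /= foldl_cat /= -/(act l _) -Hl.
by rewrite refl_conj // reflK.
Qed.

Lemma ip_word (l : seq 'I_r) (u v : V) : ip (act l u) v = ip u (act (rev l) v).
Proof.
elim: l u => //= i l IH u; rewrite IH ip_refl // rev_cons -cats1.
by rewrite /word_act foldl_cat.
Qed.

(** A dominant [lam] pairs nonnegatively with positive roots. A negative pairing thus means that
    [act (rev l)] sends [al i] to a root that is not positive, and the deletion condition shortens
    the word. *)
Lemma dominant_word_step (lam : V) (l : seq 'I_r) (i : 'I_r) :
  (forall j, 0 <= ip lam (al j)) ->
  0 <= ip (act l lam) (al i) \/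
  exists l1, (size l1 < size l)%N /\ forall v, sr i (act l v) = act l1 v.
Proof.
move=> dom; have [ge0|lt0] := lerP 0 (ip (act l lam) (al i)); [by left|right].
have [||l1] := @word_deletion (rev l) (al i) (alPhi i).
- by move=> j; rewrite dual ler0n.
- move=> pos; move: lt0; rewrite ip_word ltNge => /negP; apply.
  have wP : act (rev l) (al i) \in Phi.
    elim/last_ind: (rev l) => [|l' j IH]; first exact: alPhi.
    by rewrite -cats1 /word_act foldl_cat root_refl.
  rewrite (coordE wP) ip_sumr //; apply: sumr_ge0 => j _.
  by rewrite ipZr // mulr_ge0.
by rewrite revK size_rev; exists l1.
Qed.

End SimpleRoots.

(** * Multisets of exponents *)

Section Multisets.
Context {V : zmodType}.
Implicit Types (s t u : seq V).

Definition psum s t : seq V := [seq a + b | a <- s, b <- t].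

Definition mult s (v : V) : int := \sum_(x <- s) (x == v)%:R.

Lemma big_psum (F : V -> int) s t :
  \sum_(x <- psum s t) F x = \sum_(a <- s) \sum_(b <- t) F (a + b).
Proof. exact: big_allpairs_dep. Qed.

Lemma mult_neq0 s v : mult s v != 0 -> v \in s.
Proof.
apply: contraNT => vs; rewrite /mult big_seq big1 // => x xs.
by rewrite (negPf (memPn vs x xs)).
Qed.

(** Testing against every [F] says that [u] is the product of [s] and [t] in the group ring, without
    comparing lists up to permutation. *)
Definition convolution s t u := forall F : V -> int,
  \sum_(x <- u) F x = \sum_(a <- s) \sum_(b <- t) F (a + b).

Lemma convolution_psum s t u s' t' u' :
  convolution s t u -> convolution s' t' u' ->
  convolution (psum s s') (psum t t') (psum u u').
Proof.
move=> Hu Hu' F; rewrite big_psum Hu big_psum; apply: eq_bigr => a _.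
under eq_bigr do rewrite Hu'; rewrite exchange_big /=; apply: eq_bigr => a' _.
by rewrite big_psum; do 2![apply: eq_bigr => ? _]; rewrite addrACA.
Qed.

Lemma convolution_iter s (j k : nat) :
  convolution (iter j (psum s) [:: 0]) (iter k (psum s) [:: 0])
    (iter (j + k) (psum s) [:: 0]).
Proof.
elim: j => [|j IH] F; first by rewrite big_seq1; under [RHS]eq_bigr do rewrite add0r.
rewrite addSn /= !big_psum; apply: eq_bigr => a _; rewrite IH.
by do 2![apply: eq_bigr => ? _]; rewrite addrA.
Qed.

Definition mprod (I : Type) (o : I -> seq V) (l : seq I) (k : I -> nat) (v : V) :=
  foldr (fun i t => psum (iter (k i) (psum (o i)) [:: 0]) t) [:: v] l.

Lemma convolution_mprod (I : Type) (o : I -> seq V) (l : seq I) (j k : I -> nat)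
    (x y : V) :
  convolution (mprod o l j x) (mprod o l k y)
    (mprod o l (fun i => j i + k i)%N (x + y)).
Proof.
elim: l => [|i l IH] /=; first by move=> F; rewrite !big_seq1.
exact: convolution_psum (convolution_iter _ _ _) IH.
Qed.

Lemma eq_mprod (I : Type) (o : I -> seq V) (l : seq I)
    (j k : I -> nat) (v : V) : j =1 k -> mprod o l j v = mprod o l k v.
Proof. by move=> jk; elim: l => //= i l ->; rewrite jk. Qed.

Definition invariant_under (w : V -> V) s := forall F : V -> int,
  \sum_(x <- s) F (w x) = \sum_(x <- s) F x.

Lemma invariant_psum (w : V -> V) s t : {morph w : x y / x + y} ->
  invariant_under w s -> invariant_under w t -> invariant_under w (psum s t).
Proof.
move=> wD ws wt F; rewrite !big_psum -[RHS]ws; apply: eq_bigr => a _; rewrite -[RHS]wt.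
by apply: eq_bigr => b _; rewrite wD.
Qed.

Lemma invariant_mprod (w : V -> V) (I : Type) (o : I -> seq V) (l : seq I)
    (k : I -> nat) (v : V) : {morph w : x y / x + y} ->
  (forall i, invariant_under w (o i)) -> w 0 = 0 -> w v = v ->
  invariant_under w (mprod o l k v).
Proof.
move=> wD wo w0 wv; elim: l => [|i l IH] /=; first by move=> F; rewrite !big_seq1 wv.
apply: invariant_psum => //; elim: (k i) => [|m IHm] /=.
  by move=> F; rewrite !big_seq1 w0.
exact: invariant_psum.
Qed.

Lemma invariant_mult (w : V -> V) s (v : V) : injective w ->
  invariant_under w s -> mult s (w v) = mult s v.
Proof.
by move=> winj ws; rewrite /mult -ws; under eq_bigr do rewrite (inj_eq winj).
Qed.

(* [Q] plays the role of the cone of non-negative integral combinations of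
   simple roots, so that [leading] means "highest weight, with multiplicity one". *)
Context (Q : V -> Prop) (Q0 : Q 0) (QD : forall u v : V, Q u -> Q v -> Q (u + v)).
Context (Qpointed : forall u : V, Q u -> Q (- u) -> u = 0).

Definition leading (a : V) s := mult s a = 1 /\ forall x, x \in s -> Q (a - x).

Lemma leading1 (a : V) : leading a [:: a].
Proof.
split=> [|x]; first by rewrite /mult big_seq1 eqxx.
by rewrite inE => /eqP ->; rewrite subrr.
Qed.

(** By pointedness, [(a, b)] is the only pair of values with sum [a + b], so the two multiplicities
    multiply. *)
Lemma leading_psum (a b : V) s t :
  leading a s -> leading b t -> leading (a + b) (psum s t).
Proof.
move=> [ma Qa] [mb Qb]; split=> [|x]; last first.
  case/allpairsP => -[x1 x2] /= [/Qa Q1 /Qb Q2 ->].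
  by rewrite opprD addrACA; apply: QD.
rewrite -[RHS]mulr1 -{1}ma -mb /mult big_psum mulr_suml.
rewrite [LHS]big_seq [RHS]big_seq; apply: eq_bigr => x /Qa Qx.
rewrite mulr_sumr [LHS]big_seq [RHS]big_seq; apply: eq_bigr => y /Qb Qy.
rewrite -natrM mulnb; congr (nat_of_bool _)%:R; apply/eqP/andP; last first.
  by case=> /eqP -> /eqP ->.
move=> xyab; have ax : a - x = 0.
  apply: Qpointed => //; suff -> : - (a - x) = b - y by [].
  by apply/eqP; rewrite eq_sym -addr_eq0 addrC addrACA -opprD xyab subrr.
by move: xyab; rewrite -(subr0_eq ax) => /addrI ->.
Qed.

Lemma leading_mprod (I : Type) (o : I -> seq V) (om : I -> V) (l : seq I)
    (k : I -> nat) (v : V) : (forall i, leading (om i) (o i)) ->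
  leading (\sum_(i <- l) om i *+ k i + v) (mprod o l k v).
Proof.
move=> lo; elim: l => [|i l IH] /=; first by rewrite big_nil add0r; exact: leading1.
rewrite big_cons -addrA; apply: leading_psum => //.
elim: (k i) => [|m IHm] /=; first by rewrite mulr0n; exact: leading1.
by rewrite mulrS; apply: leading_psum.
Qed.

End Multisets.

(** * The group ring *)

Section GroupRing.
Context {R : realType} {n : nat}.
Local Notation V := 'rV[R]_n.
Local Notation A := (@Zring R n).

(** The additive extension of [F] to the group ring. Its values for all [F] determine [f], so ring
    identities are checked against an arbitrary [F]. *)
Definition pairing (f : A) (F : V -> int) : int := \sum_(v <- finsupp f) f v * F v.

Lemma pairing_widen (s : {fset V}) (f : A) (F : V -> int) :
  {subset finsupp f <= s} -> pairing f F = \sum_(v <- s) f v * F v.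
Proof.
move=> fs; rewrite /pairing [RHS](bigID (mem (finsupp f))) /=.
rewrite [X in _ + X]big1 ?addr0; last first.
  by move=> v vf; rewrite fsfun_dflt ?mul0r.
rewrite -[RHS]big_filter; apply: perm_big; apply: uniq_perm => [||v].
- exact: fset_uniq.
- by rewrite filter_uniq // fset_uniq.
by rewrite mem_filter; case: (boolP (v \in finsupp f)) => //= /fs ->.
Qed.

Lemma eq_pairing (f : A) (F G : V -> int) :
  (forall v, f v != 0 -> F v = G v) -> pairing f F = pairing f G.
Proof.
move=> FG; rewrite /pairing big_seq [RHS]big_seq; apply: eq_bigr => v.
by rewrite mem_finsupp => /FG ->.
Qed.

Lemma pairing_delta (f : A) (v : V) : pairing f (fun u => (u == v)%:R) = f v.
Proof.
rewrite (@pairing_widen (v |` finsupp f)%fset); last first.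
  by move=> u uf; rewrite in_fset1U uf orbT.
rewrite (bigD1_seq v) ?fset_uniq ?in_fset1U ?eqxx //= mulr1.
by rewrite big1 ?addr0 // => u /negPf ->; rewrite mulr0.
Qed.

Lemma pairing_inj (f g : A) : (forall F, pairing f F = pairing g F) -> f = g.
Proof. by move=> fg; apply/fsfunP => v; rewrite -!pairing_delta fg. Qed.

Lemma pairing_sum (I : Type) (s : seq I) (f : A) (F : I -> V -> int) :
  pairing f (fun a => \sum_(i <- s) F i a) = \sum_(i <- s) pairing f (F i).
Proof.
rewrite /pairing exchange_big /=; apply: eq_bigr => a _.
by rewrite mulr_sumr.
Qed.

Lemma pairingMl (f : A) (F : V -> int) (c : int) :
  pairing f F * c = pairing f (fun a => F a * c).
Proof. by rewrite /pairing mulr_suml; apply: eq_bigr => a _; rewrite mulrA. Qed.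

Lemma gaddE (f g : A) (v : V) : gadd f g v = f v + g v.
Proof.
rewrite /gadd fsfunE in_fsetU; case: ifPn => //.
by rewrite negb_or => /andP [vf vg]; rewrite !fsfun_dflt ?addr0.
Qed.

Lemma pairing_gadd (f g : A) (F : V -> int) :
  pairing (gadd f g) F = pairing f F + pairing g F.
Proof.
pose s := (finsupp f `|` finsupp g)%fset.
rewrite !(@pairing_widen s) => [|v|v|v].
- by rewrite -big_split; apply: eq_bigr => v _; rewrite gaddE mulrDl.
- by rewrite in_fsetU => ->; rewrite orbT.
- by rewrite in_fsetU => ->.
rewrite in_fsetU !mem_finsupp gaddE; apply: contraR; rewrite negb_or !negbK.
by case/andP => /eqP -> /eqP ->.
Qed.

Lemma gmulE (f g : A) (v : V) :
  gmul f g v = pairing f (fun a => pairing g (fun b => (a + b == v)%:R)).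
Proof.
have -> : pairing f (fun a => pairing g (fun b => (a + b == v)%:R)) =
  \sum_(a <- finsupp f) \sum_(b <- finsupp g | a + b == v) f a * g b.
  apply: eq_bigr => a _; rewrite mulr_sumr [RHS]big_mkcond; apply: eq_bigr => b _.
  by case: eqP; rewrite ?mulr1 ?mulr0.
rewrite /gmul fsfunE; case: ifPn => // vfg.
rewrite big_seq big1 // => a af; rewrite big_seq_cond big1 // => b /andP [bg /eqP abv].
by case/negP: vfg; apply/imfset2P; exists a => //; exists b.
Qed.

Lemma pairing_gmul (f g : A) (F : V -> int) :
  pairing (gmul f g) F = pairing f (fun a => pairing g (fun b => F (a + b))).
Proof.
pose s := [fset (a + b)%R | a in finsupp f, b in finsupp g]%fset.
rewrite (@pairing_widen s) => [|v]; last first.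
  by rewrite mem_finsupp /gmul fsfunE; case: ifP; rewrite ?eqxx.
under eq_bigr => v _ do rewrite gmulE pairingMl.
rewrite -pairing_sum; apply: eq_pairing => a fa.
under eq_bigr => v _ do rewrite pairingMl.
rewrite -pairing_sum; apply: eq_pairing => b gb.
have abs : a + b \in s.
  by apply/imfset2P; exists a; rewrite ?mem_finsupp //; exists b; rewrite ?mem_finsupp.
rewrite (bigD1_seq (a + b)) ?fset_uniq //= eqxx mul1r big1 ?addr0 // => v.
by rewrite eq_sym => /negPf ->; rewrite mul0r.
Qed.

Lemma pairing_gone (F : V -> int) : pairing gone F = F 0.
Proof.
rewrite (@pairing_widen [fset 0]%fset) => [|v].
  by rewrite big_seq_fset1 /gone fsfunE in_fset1 eqxx mul1r.
by rewrite mem_finsupp /gone fsfunE; case: ifP; rewrite ?eqxx.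
Qed.

(** The additive map determined by its values on the [chi^lam], each value being encoded by a list
    of exponents with repetitions. *)
Definition extend (mono : V -> seq V) (f : A) : A :=
  [fsfun v in [fset v in flatten [seq mono lam | lam <- finsupp f]]%fset =>
     \sum_(lam <- finsupp f) f lam * mult (mono lam) v].

Lemma extendE (mono : V -> seq V) (f : A) (v : V) :
  extend mono f v = \sum_(lam <- finsupp f) f lam * mult (mono lam) v.
Proof.
rewrite /extend fsfunE in_fset /=; case: ifPn => // vN.
rewrite big_seq big1 // => lam lamf.
have [->|/mult_neq0 vm] := eqVneq (mult (mono lam) v) 0; first by rewrite mulr0.
by case/negP: vN; apply/flattenP; exists (mono lam) => //; apply: map_f.
Qed.

Lemma pairing_extend (mono : V -> seq V) (f : A) (F : V -> int) :
  pairing (extend mono f) F = pairing f (fun lam => \sum_(v <- mono lam) F v).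
Proof.
pose s := [fset v in flatten [seq mono lam | lam <- finsupp f]]%fset.
rewrite (@pairing_widen s) => [|v]; last first.
  by rewrite mem_finsupp /extend fsfunE; case: ifP; rewrite ?eqxx.
under eq_bigr => v _ do rewrite extendE mulr_suml.
rewrite exchange_big /= /pairing big_seq [RHS]big_seq; apply: eq_bigr => lam lamf.
under eq_bigr => v _ do rewrite -mulrA /mult mulr_suml.
rewrite -mulr_sumr exchange_big /=; congr (_ * _).
rewrite big_seq [RHS]big_seq; apply: eq_bigr => x xm.
have xs : x \in s.
  by rewrite in_fset; apply/flattenP; exists (mono lam) => //; apply: map_f.
rewrite (bigD1_seq x) ?fset_uniq //= eqxx mul1r big1 ?addr0 // => v.
by rewrite eq_sym => /negPf ->; rewrite mul0r.
Qed.

End GroupRing.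

(** * Weights and the isomorphism *)

Lemma seq_argmax (d : Order.disp_t) (U : orderType d) (T : eqType) (f : T -> U)
    (x0 : T) (s : seq T) : x0 \in s ->
  exists2 x, x \in s & forall y, y \in s -> (f y <= f x)%O.
Proof.
elim: s x0 => // a s IH x0 _; case: s IH => [_|b s IH].
  by exists a => [|y]; rewrite !inE // => /eqP ->.
have [x xs xmax] := IH b (mem_head b s).
have [ax|xa] := leP (f a) (f x).
  by exists x => [|y]; rewrite inE ?xs ?orbT // => /orP [/eqP ->//|/xmax].
exists a => [|y]; first exact: mem_head.
by rewrite inE => /orP [/eqP ->//|/xmax /le_trans]; apply; apply: ltW.
Qed.

Section Weights.
Context {R : realType} {n r : nat} (B : 'M[R]_n) (posB : posdef_sym B).
Local Notation V := 'rV[R]_n.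
Local Notation ip := (ip B).
Local Notation s := (reflmap B).
Context (W : seq 'M[R]_n) (be om : 'I_r -> V) (rho : V).
Local Notation act := (word_act B be).

(** The value of the coroot of [b] on [v], that is, the coefficient of [b] in [v - s b v]. *)
Definition coroot_pairing (b v : V) : R := 2 * ip v b / ip b b.
Local Notation kk i v := (coroot_pairing (be i) v).

Context (groupW : finite_subgroup_GL W).
Context (be_neq0 : forall i, be i != 0).
Context (cartan_int : forall i j, kk i (be j) \is a Num.int).
Context (omE : forall i j, kk i (om j) = (i == j)%:R).
Context (ht_be : forall i, ip (be i) rho = 1).
Context (rho_span : exists c : 'I_r -> R, rho = \sum_i c i *: be i).
Context (Wrefl : forall i, refl_mx B (be i) \in W).
Context (Wword : forall w, w \in W -> exists l, forall v, v *m w = act l v).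
Context (word_step : forall lam, (forall j, 0 <= ip lam (be j)) -> forall l i,
  0 <= ip (act l lam) (be i) \/
  exists l1, (size l1 < size l)%N /\ forall v, s (be i) (act l v) = act l1 v).

Local Notation dominant v := (forall i, 0 <= ip v (be i)).
Local Notation ht v := (ip v rho).

Lemma reflE (i : 'I_r) (v : V) : s (be i) v = v - kk i v *: be i.
Proof. by []. Qed.

Lemma coroot_pairingD (b u v : V) :
  coroot_pairing b (u + v) = coroot_pairing b u + coroot_pairing b v.
Proof. by rewrite /coroot_pairing ipDl mulrDr mulrDl. Qed.

Lemma coroot_pairingZ (b : V) (c : R) (v : V) :
  coroot_pairing b (c *: v) = c * coroot_pairing b v.
Proof. by rewrite /coroot_pairing ipZl; ring. Qed.

Lemma coroot_pairingB (b u v : V) :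
  coroot_pairing b (u - v) = coroot_pairing b u - coroot_pairing b v.
Proof. by rewrite -scaleN1r coroot_pairingD coroot_pairingZ mulN1r. Qed.

Lemma coroot_pairing_sum (b : V) (I : Type) (l : seq I) (F : I -> V) :
  coroot_pairing b (\sum_(i <- l) F i) = \sum_(i <- l) coroot_pairing b (F i).
Proof. by rewrite /coroot_pairing ip_suml mulr_sumr mulr_suml. Qed.

Lemma coroot_pairing_ge0 (i : 'I_r) (v : V) : (0 <= kk i v) = (0 <= ip v (be i)).
Proof.
by rewrite /coroot_pairing mulrAC pmulr_rge0 // divr_gt0 ?ip_gt0 ?ltr0n.
Qed.

(** * The cone of scaled simple roots *)

Definition root_cone (v : V) := exists k : 'I_r -> nat, v = \sum_i be i *+ k i.

Lemma root_cone0 : root_cone 0.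
Proof. by exists (fun=> 0%N); rewrite big1. Qed.

Lemma root_coneD (u v : V) : root_cone u -> root_cone v -> root_cone (u + v).
Proof.
move=> [j ->] [k ->]; exists (fun i => j i + k i)%N.
by rewrite -big_split; apply: eq_bigr => i _; rewrite mulrnDr.
Qed.

Lemma root_coneMn (i : 'I_r) (m : nat) : root_cone (be i *+ m).
Proof.
exists (fun j => if j == i then m else 0%N).
by rewrite (bigD1 i) //= eqxx big1 ?addr0 // => j /negPf ->.
Qed.

Lemma coroot_pairing_cone (i : 'I_r) (v : V) : root_cone v -> kk i v \is a Num.int.
Proof.
move=> [k ->]; rewrite coroot_pairing_sum rpred_sum // => j _.
by rewrite -scaler_nat coroot_pairingZ rpredM // intr_nat.
Qed.

(** Each scaled simple root has height 1, so heights on the cone are natural numbers. The gap of 1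
    gives pointedness and drives the induction for surjectivity. *)
Lemma ht_root_cone (v : V) : root_cone v -> v = 0 \/ 1 <= ht v.
Proof.
move=> [k vE]; have htE : ht v = (\sum_i k i)%:R.
  rewrite vE ip_suml natr_sum; apply: eq_bigr => i _.
  by rewrite -scaler_nat ipZl ht_be mulr1.
have [k0|kpos] := posnP (\sum_i k i)%N; last by right; rewrite htE ler1n.
left; rewrite vE big1 // => i _; move/eqP: k0.
by rewrite sum_nat_eq0 => /forallP /(_ i) /eqP ->.
Qed.

Lemma root_cone_pointed (u : V) : root_cone u -> root_cone (- u) -> u = 0.
Proof.
move=> /ht_root_cone [//|ge1] /ht_root_cone [/eqP|]; first by rewrite oppr_eq0 => /eqP.
by rewrite ipNl => le1; exfalso; lra.
Qed.

(** A last letter with nonnegative pairing subtracts a natural multiple of a scaled simple root; in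
    the other case [word_step] provides a shorter word, which need not be a prefix, hence the strong
    induction on length. *)
Lemma dominant_weight_sub_act (lam : V) (l : seq 'I_r) :
  (forall i, kk i lam \is a Num.nat) -> root_cone (lam - act l lam).
Proof.
move=> natl; have dom : dominant lam by move=> i; rewrite -coroot_pairing_ge0 natr_ge0.
have [N] := ubnP (size l); elim: N l => // N IH l; rewrite ltnS.
case/lastP: l => [|l i]; first by rewrite subrr => _; exact: root_cone0.
rewrite size_rcons => szl; rewrite -cats1 /word_act foldl_cat /= -/(act l lam).
have [ge0|[l1 [szl1 ->]]] := word_step dom l i; last first.
  by apply: IH; apply: leq_trans szl; apply: ltnW.
have Ql := IH _ szl.
(* The pairing is an integer because [act l lam] differs from [lam] by an element of the cone. *)
have /natrP [m Hm] : kk i (act l lam) \is a Num.nat.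
  rewrite natrEint coroot_pairing_ge0 ge0 andbT -[act l lam](subKr lam).
  rewrite coroot_pairingB rpredB ?(coroot_pairing_cone i Ql) //.
  by have := natl i; rewrite natrEint => /andP [].
rewrite reflE Hm scaler_nat opprB addrCA.
by apply: root_coneD => //; exact: root_coneMn.
Qed.

Lemma act_fixed (v : V) (l : seq 'I_r) : (forall i, kk i v = 0) -> act l v = v.
Proof.
move=> v0; elim: l => //= i l IH.
by rewrite /word_act /= reflE v0 scale0r subr0.
Qed.

(** * Dominant representatives of orbits *)

Lemma mulW_perm (w : 'M[R]_n) : w \in W ->
  perm_eq [seq g *m w | g <- undup W] (undup W).
Proof.
case: groupW => _ Wu WM WV wW.
have inj : injective (fun g : 'M[R]_n => g *m w).
  by apply: (can_inj (g := mulmx^~ (invmx w))) => g; rewrite mulmxK // Wu.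
apply: uniq_perm => [||g]; rewrite ?map_inj_uniq ?undup_uniq //.
apply/mapP/idP => [[h]|]; rewrite mem_undup => gW.
  by move=> ->; rewrite mem_undup WM.
by exists (g *m invmx w); rewrite ?mem_undup ?WM ?WV // mulmxKV // Wu.
Qed.

(** A conjugate of maximal height is dominant, since no simple reflection can raise it. *)
Lemma exists_dominant (v : V) : exists2 w, w \in W &
  [/\ dominant (v *m w), 0 <= ht (v *m w) & ht v <= ht (v *m w)].
Proof.
have [W1 Wu WM _] := groupW.
have [w wW wmax] := @seq_argmax _ R _ (fun w => ht (v *m w)) _ _ W1.
exists w => //; split; last by have := wmax _ W1; rewrite mulmx1.
  move=> i; have := wmax _ (WM _ _ wW (Wrefl i)).
  rewrite mulmxA mul_refl_mx reflE ipBl ipZl ht_be mulr1 -coroot_pairing_ge0.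
  by rewrite gerBl.
(* The sum over the group is fixed by the simple reflections, hence orthogonal to every [be i] and
   so to [rho]. The heights of the conjugates thus add up to 0, and their maximum is not
   negative. *)
pose Y := \sum_(g <- undup W) v *m g.
have Y0 i : ip Y (be i) = 0.
  have : s (be i) Y = Y.
    rewrite -mul_refl_mx /Y mulmx_suml; under eq_bigr do rewrite -mulmxA.
    by rewrite -(big_map (fun g => g *m _) predT (fun g => v *m g))
      (perm_big _ (mulW_perm (Wrefl i))).
  move/eqP; rewrite reflE -subr_eq0 addrC addKr oppr_eq0 scaler_eq0.
  rewrite (negPf (be_neq0 i)) orbF.
  rewrite /coroot_pairing mulf_eq0 invr_eq0 (gt_eqF (ip_gt0 posB (be_neq0 i))) orbF.
  by rewrite mulf_eq0 pnatr_eq0 => /eqP.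
have : ht Y = 0.
  have [c ->] := rho_span; rewrite ip_sumr // big1 // => i _.
  by rewrite ipZr // Y0 mulr0.
rewrite /Y ip_suml => sum0; rewrite leNgt; apply/negP => lt0.
suff : \sum_(g <- undup W) ht (v *m g) < 0 by rewrite sum0 ltxx.
rewrite (bigD1_seq 1%:M) ?undup_uniq ?mem_undup //=.
have neg g : g \in W -> ht (v *m g) < 0.
  by move=> gW; apply: le_lt_trans lt0; apply: wmax.
rewrite big_seq_cond; apply: ltr_wnDr; last exact: neg.
by apply: sumr_le0 => g /andP [/[!mem_undup] /neg /ltW].
Qed.

(** * Orbit sums and monomials *)

Definition orbit_seq (v : V) : seq V := undup [seq v *m w | w <- W].

Definition fixed_part (v : V) := v - \sum_i kk i v *: om i.

(* The expansion of [chi^lam0 * prod_i x_i^(k_i)], where [x_i] is the orbit sum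
   of the fundamental weight [om i] and [lam = lam0 + sum_i k_i om_i] with [lam0]
   fixed by [W]; an element of Z[V] with natural coefficients is encoded by the
   list of its exponents, repeated according to multiplicity. *)
Definition monomial (lam : V) : seq V :=
  mprod (fun i => orbit_seq (om i)) (index_enum 'I_r)
    (fun i => Num.truncn (kk i lam)) (fixed_part lam).

Local Notation weight v := (forall i, kk i v \is a Num.nat).

(** Subtracting the [om i] components makes all coroot pairings vanish, so words in the simple
    reflections act trivially. *)
Lemma fixed_partP (w : 'M[R]_n) (v : V) : w \in W ->
  fixed_part v *m w = fixed_part v.
Proof.
move=> /Wword [l ->]; apply: act_fixed => i.
rewrite /fixed_part coroot_pairingB coroot_pairing_sum (bigD1 i) //=.
rewrite coroot_pairingZ omE eqxx mulr1 big1 ?addr0 ?subrr // => j ji.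
by rewrite coroot_pairingZ omE eq_sym (negPf ji) mulr0.
Qed.

Lemma mulmx_inj (w : 'M[R]_n) : w \in W -> injective (fun v : V => v *m w).
Proof.
have [_ Wu _ _] := groupW => /Wu wu.
by apply: (can_inj (g := mulmx^~ (invmx w))) => v; rewrite mulmxK.
Qed.

Lemma orbit_seq_invariant (w : 'M[R]_n) (v : V) : w \in W ->
  invariant_under (mulmx^~ w) (orbit_seq v).
Proof.
move=> wW F; rewrite -(big_map (mulmx^~ w) predT F); apply: perm_big.
have [_ Wu WM WV] := groupW.
have inj := mulmx_inj wW.
apply: uniq_perm => [||u]; rewrite ?map_inj_uniq ?undup_uniq //.
apply/mapP/idP => [[u1]|]; rewrite mem_undup => /mapP [g gW ->].
  by move=> ->; rewrite mem_undup -mulmxA; apply: map_f; rewrite WM.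
exists (v *m (g *m invmx w)); last by rewrite -!mulmxA mulVmx ?mulmx1 ?Wu.
by rewrite mem_undup; apply: map_f; rewrite WM ?WV.
Qed.

(** Multiplicity one holds even if [lam] has a nontrivial stabilizer, because [orbit_seq] removes
    duplicates. *)
Lemma orbit_seq_leading (lam : V) : weight lam ->
  leading root_cone lam (orbit_seq lam).
Proof.
move=> wlam; split=> [|x]; last first.
  rewrite mem_undup => /mapP [w /Wword [l ->] ->]; exact: dominant_weight_sub_act.
have [W1 _ _ _] := groupW.
rewrite /mult (bigD1_seq lam) ?undup_uniq ?eqxx //=; last first.
  by rewrite mem_undup; apply/mapP; exists 1%:M; rewrite ?mulmx1.
by rewrite big1 ?addr0 // => x /negPf ->.
Qed.

Lemma monomial_mult (w : 'M[R]_n) (lam v : V) : w \in W ->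
  mult (monomial lam) (v *m w) = mult (monomial lam) v.
Proof.
move=> wW; apply: (@invariant_mult _ (mulmx^~ w)); first exact: mulmx_inj.
apply: invariant_mprod => [u u'|i||]; first exact: mulmxDl.
- exact: orbit_seq_invariant.
- exact: mul0mx.
- exact: fixed_partP.
Qed.

Lemma monomial_leading (lam : V) : weight lam -> leading root_cone lam (monomial lam).
Proof.
move=> wlam; have -> : leading root_cone lam =
    leading root_cone (\sum_i om i *+ Num.truncn (kk i lam) + fixed_part lam).
  rewrite addrC; under [in RHS]eq_bigr do rewrite -scaler_nat truncnK //.
  by rewrite subrK.
apply: (leading_mprod root_cone0 root_coneD root_cone_pointed) => i.
by apply: orbit_seq_leading => j; rewrite omE natr_nat.
Qed.

(** Exponents of the orbit sums add up because the pairings are natural; on negative values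
    [Num.truncn] is 0 and additivity would fail. *)
Lemma monomialD (lam mu : V) : weight lam -> weight mu ->
  convolution (monomial lam) (monomial mu) (monomial (lam + mu)).
Proof.
move=> wl wm; rewrite {3}/monomial.
have -> : fixed_part (lam + mu) = fixed_part lam + fixed_part mu.
  rewrite /fixed_part addrACA -opprD -big_split; congr (_ - _).
  by apply: eq_bigr => i _; rewrite coroot_pairingD scalerDl.
rewrite (@eq_mprod _ _ _ _ _ (fun i => Num.truncn (kk i lam) + Num.truncn (kk i mu))%N).
  exact: convolution_mprod.
by move=> i; rewrite coroot_pairingD truncnD // nnegrE natr_ge0.
Qed.

Lemma monomial0 (F : V -> int) : \sum_(x <- monomial 0) F x = F 0.
Proof.
have k0 i : kk i 0 = 0 by rewrite /coroot_pairing ip0l mulr0 mul0r.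
have -> : monomial 0 =
    mprod (fun i => orbit_seq (om i)) (index_enum 'I_r) (fun=> 0%N) 0.
  rewrite /monomial; have -> : fixed_part 0 = 0.
    by rewrite /fixed_part big1 ?subr0 // => i _; rewrite k0 scale0r.
  by apply: eq_mprod => i; rewrite k0 truncn0.
elim: (index_enum _) F => [|i l IH] F /=; first by rewrite big_seq1.
by rewrite big_psum big_seq1 IH addr0.
Qed.

(** * Descent inside the semigroup *)

Context (M S : V -> Prop).
Context (MB : forall u v, M u -> M v -> M (u - v)) (M_be : forall i, M (be i)).
Context (M_int : forall v i, M v -> kk i v \is a Num.int).
Context (SM : forall v, S v -> M v) (S0 : S 0).
Context (SD : forall u v, S u -> S v -> S (u + v)).
Context (S_sat : forall (k : nat) (m : V), (0 < k)%N -> M m -> S (k%:R *: m) -> S m).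
Context (SW : forall w v, w \in W -> S v -> S (v *m w)).

Lemma dominant_weight (v : V) : dominant v -> S v -> weight v.
Proof. by move=> dv Sv i; rewrite natrEint M_int ?coroot_pairing_ge0 ?dv; auto. Qed.

Lemma S_natmul (k : nat) (v : V) : S v -> S (k%:R *: v).
Proof.
move=> Sv; elim: k => [|k IH]; first by rewrite scale0r.
by rewrite -natr1 scalerDl scale1r; apply: SD.
Qed.

(* [m (v - be i) = (m - 1) v + s_i v] for [m = kk i v >= 1]. *)
Lemma S_sub_root (i : 'I_r) (v : V) : S v -> 0 < ip v (be i) -> S (v - be i).
Proof.
move=> Sv pos; have : kk i v \is a Num.nat.
  by rewrite natrEint M_int ?coroot_pairing_ge0 ?ltW //; auto.
move=> /natrP [m km].
have : 0 < kk i v.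
  by rewrite /coroot_pairing mulrAC pmulr_rgt0 // divr_gt0 ?ip_gt0 ?ltr0n.
rewrite km ltr0n; case: m km => // m km _.
apply: (@S_sat m.+1) => //; first by apply: MB; auto.
have -> : m.+1%:R *: (v - be i) = m%:R *: v + s (be i) v.
  by rewrite reflE km scalerBr addrA -natr1 scalerDl scale1r.
apply: SD; first exact: S_natmul.
by rewrite -mul_refl_mx; apply: SW.
Qed.

(** Positivity of the form on [lam - mu] yields some [i] with [0 < k i] and [lam - mu] pairing
    positively with [be i]. As [mu] is dominant, [lam] does too, and [be i] can be subtracted inside
    [S]. *)
Lemma S_dominated (lam mu : V) :
  S lam -> dominant mu -> root_cone (lam - mu) -> S mu.
Proof.
move=> Sl dmu [k]; have [N] := ubnP (\sum_i k i)%N.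
elim: N lam k Sl => // N IH lam k Sl; rewrite ltnS => leN lmE.
have [lm0|lm0] := eqVneq (lam - mu) 0; first by rewrite -(subr0_eq lm0).
have [i ki posi] : exists2 i, (0 < k i)%N & 0 < ip (lam - mu) (be i).
  have := ip_gt0 posB lm0; rewrite {2}lmE ip_sumr // => sum_gt0.
  have [i _ Hi] : exists2 i, true & 0 < ip (lam - mu) (be i *+ k i).
    apply/exists_inP; apply: contraLR sum_gt0; rewrite negb_exists_in.
    move=> /forall_inP Hle.
    by rewrite -leNgt sumr_le0 // => i _; rewrite leNgt Hle.
  exists i; first by rewrite lt0n; apply: contraTneq Hi => ->;
    rewrite mulr0n ipC // ip0l ltxx.
  move: Hi; rewrite -scaler_nat ipZr // => Hi.
  by rewrite ltNge; apply: contraTN Hi => le0; rewrite -leNgt mulr_ge0_le0.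
(* The truncated subtraction is exact at [i] because [0 < k i]. *)
apply: (IH (lam - be i) (fun j => k j - (j == i))%N).
- apply: S_sub_root => //; rewrite -(subrK mu lam) ipDl.
  by rewrite ltr_wpDr.
- apply: leq_trans leN; rewrite (bigD1 i) //= [X in (_ < X)%N](bigD1 i) //= eqxx.
  rewrite -addSn subn1 prednK // leq_add2l; apply: leq_sum => j _; exact: leq_subr.
rewrite addrAC lmE; apply/eqP; rewrite subr_eq; apply/eqP.
rewrite (bigD1 i) //= [in RHS](bigD1 i) //= eqxx [RHS]addrAC; congr (_ + _).
  by rewrite -mulrSr subn1 prednK.
by apply: eq_bigr => j /negPf ->; rewrite subn0.
Qed.

(** By invariance [v] may be replaced by a dominant conjugate, which lies below [lam], hence in
    [S]. *)
Lemma monomial_S (lam v : V) :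
  dominant lam -> S lam -> mult (monomial lam) v != 0 -> S v.
Proof.
move=> dl Sl; have [w wW [dvw _ _]] := exists_dominant v.
rewrite -(monomial_mult lam v wW) => /mult_neq0 vm.
have [_ lead] := monomial_leading (dominant_weight dl Sl).
have Svw := S_dominated Sl dvw (lead _ vm).
have [_ Wu _ WV] := groupW.
by rewrite -(mulmxK (Wu _ wW) v); apply: SW => //; apply: WV.
Qed.

(** * The ring isomorphism *)

Local Notation A := (@Zring R n).
Local Notation phi := (extend monomial).
Local Notation DS := (supported_in (fun v => dominant v /\ S v)).

Lemma monomial_support (lam v : V) : weight lam -> mult (monomial lam) v != 0 ->
  v = lam \/ ht v + 1 <= ht lam.
Proof.
move=> wlam /mult_neq0 vm; have [_ /(_ _ vm) /ht_root_cone] := monomial_leading wlam.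
by rewrite ipBl => -[/subr0_eq ->|]; [left|right; lra].
Qed.

Lemma extend_W_invariant (f : A) : W_invariant W (phi f).
Proof.
by move=> w wW v; rewrite !extendE; apply: eq_bigr => lam _; rewrite monomial_mult.
Qed.

Lemma extend_supported (f : A) : DS f -> supported_in S (phi f).
Proof.
move=> DSf v; rewrite extendE => sum_neq0.
have [lam lf] : exists2 lam, lam \in finsupp f & f lam * mult (monomial lam) v != 0.
  apply/hasP; apply: contraR sum_neq0 => /hasPn Hno.
  by rewrite big_seq big1 // => lam /Hno /negPn /eqP.
rewrite mulf_eq0 negb_or => /andP [/DSf [dl Sl]]; exact: monomial_S.
Qed.

Lemma extend_gadd (f g : A) : phi (gadd f g) = gadd (phi f) (phi g).
Proof.
by apply: pairing_inj => F; rewrite pairing_extend !pairing_gadd !pairing_extend.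
Qed.

Lemma extend_gmul (f g : A) : DS f -> DS g -> phi (gmul f g) = gmul (phi f) (phi g).
Proof.
move=> DSf DSg; apply: pairing_inj => F.
rewrite pairing_extend !pairing_gmul pairing_extend; apply: eq_pairing => lam.
move=> /DSf [dl Sl]; under [RHS]eq_bigr do rewrite pairing_extend.
rewrite -pairing_sum; apply: eq_pairing => mu /DSg [dm Sm].
exact: monomialD (dominant_weight dl Sl) (dominant_weight dm Sm) F.
Qed.

Lemma extend_gone : phi gone = gone.
Proof.
by apply: pairing_inj => F; rewrite pairing_extend !pairing_gone monomial0.
Qed.

(** At a highest [lam] where [f] and [g] differ, no other differing exponent contributes, so the
    coefficients of the images differ by [f lam - g lam]. *)
Lemma extend_inj (f g : A) : DS f -> DS g -> phi f = phi g -> f = g.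
Proof.
move=> DSf DSg fg; apply/fsfunP => v0; apply/eqP; apply: contraT => fg0.
pose s := (finsupp f `|` finsupp g)%fset.
have diff_s v : f v != g v -> v \in [seq x <- s | f x != g x].
  move=> fgv; rewrite mem_filter fgv in_fsetU !mem_finsupp -negb_and.
  by apply: contra fgv => /andP [/eqP -> /eqP ->].
have [lam] := @seq_argmax _ R _ (fun v => ht v) _ _ (diff_s _ fg0).
rewrite mem_filter => /andP [fgl ls] lmax.
have phiE (h : A) : {subset finsupp h <= s} ->
    phi h lam = \sum_(mu <- s) h mu * mult (monomial mu) lam.
  move=> hs; rewrite extendE; exact: pairing_widen hs.
have weight_s mu : mu \in s -> weight mu.
  rewrite in_fsetU !mem_finsupp => /orP [/DSf|/DSg] [dm Sm]; exact: dominant_weight.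
have : phi f lam - phi g lam = f lam - g lam.
  rewrite !phiE => [|v vg|v vf]; rewrite ?in_fsetU ?vg ?vf ?orbT //.
  rewrite -sumrB (bigD1_seq lam) ?fset_uniq //= -mulrBl.
  have [-> _] := monomial_leading (weight_s _ ls).
  rewrite mulr1 big_seq_cond big1 ?addr0 // => mu /andP [ms mul].
  rewrite -mulrBl; have [->|fgm] := eqVneq (f mu) (g mu); first by rewrite subrr mul0r.
  have [->|/(monomial_support (weight_s _ ms)) [lm|]] :=
    eqVneq (mult (monomial mu) lam) 0.
  - by rewrite mulr0.
  - by rewrite lm eqxx in mul.
  by move=> /le_trans /(_ (lmax _ (diff_s _ fgm))); rewrite gerDl ler10.
by rewrite fg subrr => /esym /eqP; rewrite subr_eq0 (negPf fgl).
Qed.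

(* Induction on a bound for the heights in the support: the dominant terms of [h]
   of height at least [N] are cancelled by the image of their restriction, whose
   other terms have height smaller by at least one. *)
Lemma extend_surj (h : A) : supported_in S h -> W_invariant W h ->
  exists f, DS f /\ phi f = h.
Proof.
have [N] : exists N : nat, forall v, h v != 0 -> ht v < N%:R.
  (* Adjoining 0 keeps the list nonempty when [h] is zero. *)
  have [v _ vmax] := @seq_argmax _ R _ (fun v => ht v) _ _ (mem_head 0 (finsupp h)).
  exists (Num.truncn (ht v)).+1 => u hu; apply: le_lt_trans (truncnS_gt _).
  by apply: vmax; rewrite inE mem_finsupp hu orbT.
elim: N h => [|N IH] h ltN Sh Wh.
  (* Here [h] must vanish: any exponent in its support has a conjugate of nonnegative height, also
     in the support, against the bound 0. *)
  exists [fsfun]%fset; split=> [v|]; first by rewrite fsfun0E eqxx.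
  apply/fsfunP => v; rewrite extendE finsupp0 big_seq_fset0.
  apply/eqP; apply: contraT; rewrite eq_sym => hv.
  have [w wW [_ ge0 _]] := exists_dominant v.
  by have := ltN (v *m w); rewrite Wh // => /(_ hv); rewrite ltNge ge0.
pose top v := [forall i, 0 <= ip v (be i)] && (N%:R <= ht v).
pose f1 : A := [fsfun v in finsupp h => if top v then h v else 0].
have f1E v : f1 v = if top v then h v else 0.
  by rewrite fsfunE; case: ifPn => //; rewrite memNfinsupp => /eqP ->; case: ifP.
have DSf1 : DS f1.
  move=> v; rewrite f1E; case: ifP => [/andP [/forallP dv _] hv|]; last by rewrite eqxx.
  by split=> //; apply: Sh.
pose h' : A := [fsfun v in (finsupp h `|` finsupp (phi f1))%fset => h v - phi f1 v].
have h'E v : h' v = h v - phi f1 v.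
  rewrite fsfunE; case: ifPn => //; rewrite in_fsetU negb_or => /andP [vh vf].
  by rewrite !fsfun_dflt ?subrr.
have Wh' : W_invariant W h' by move=> w wW v; rewrite !h'E Wh // extend_W_invariant.
have [||f2 [DSf2 f2E]] := IH h' _ _ Wh'.
(* An exponent of [h'] of height at least [N] has a dominant conjugate [v] of no smaller height, and
   there the coefficient of [phi f1] equals [h v]. *)
- move=> v0; rewrite ltNge => h'v0; apply/negP => geN0.
  have [w wW [dv _ le_ht]] := exists_dominant v0.
  move: h'v0 (le_trans geN0 le_ht); rewrite -(Wh' w wW).
  move: (v0 *m w) dv => v dv h'v geN.
  have topv : top v by rewrite /top geN andbT; apply/forallP.
  move: h'v; rewrite h'E extendE.
  (* Another [lam] contributing at [v] would have height at least [N + 1], beyond the bound on the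
     support of [h]. *)
  have f1_other lam : lam \in finsupp f1 -> lam != v -> mult (monomial lam) v = 0.
    rewrite mem_finsupp => f1l lv; have [dl Sl] := DSf1 _ f1l.
    apply/eqP; apply: contraT => /(monomial_support (dominant_weight dl Sl)) [vl|].
      by rewrite vl eqxx in lv.
    have /ltN : h lam != 0 by move: f1l; rewrite f1E; case: ifP; rewrite ?eqxx.
    by rewrite -natr1; lra.
  suff -> : \sum_(lam <- finsupp f1) f1 lam * mult (monomial lam) v = h v.
    by rewrite subrr eqxx.
  have [hv0|hv] := eqVneq (h v) 0.
    rewrite hv0 big_seq big1 // => lam lf; rewrite f1_other ?mulr0 //.
    by apply: contraTneq lf => ->; rewrite memNfinsupp f1E hv0 if_same.
  have f1v : f1 v = h v by rewrite f1E topv.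
  have [dlv Sv] : dominant v /\ S v by apply: DSf1; rewrite f1v.
  rewrite (bigD1_seq v) ?fset_uniq ?mem_finsupp ?f1v //=.
  have [-> _] := monomial_leading (dominant_weight dlv Sv).
  rewrite mulr1 big_seq_cond big1 ?addr0 // => lam /andP [lf lv].
  by rewrite f1_other ?mulr0.
- move=> v; rewrite h'E => hv; have [h0|/Sh //] := eqVneq (h v) 0.
  apply: (extend_supported DSf1); apply: contraNneq hv => ->.
  by rewrite h0 subr0.
exists (gadd f1 f2); split=> [v|].
  rewrite gaddE => f12; have [f10|/DSf1 //] := eqVneq (f1 v) 0.
  by apply: DSf2; move: f12; rewrite f10 add0r.
rewrite extend_gadd f2E; apply/fsfunP => v; rewrite gaddE h'E.
by rewrite addrC subrK.
Qed.

Lemma extend_iso : ring_iso_between DS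
  (fun f => supported_in S f /\ W_invariant W f) phi.
Proof.
split=> [f DSf||f g DSf DSg|h [Sh Wh]].
- by split; [exact: extend_supported | exact: extend_W_invariant].
- by split=> [f g _ _|]; [|split=> [f g|]];
    [exact: extend_gadd|exact: extend_gmul|exact: extend_gone].
- exact: extend_inj.
- exact: extend_surj.
Qed.

End Weights.

(** * Roots scaled to the lattice *)

Section Lattice.
Context {R : realType} {n : nat} (B : 'M[R]_n) (posB : posdef_sym B).
Local Notation V := 'rV[R]_n.
Local Notation ip := (ip B).
Context (M : V -> Prop) (latM : is_lattice M).

Lemma lattice_sub (u v : V) : M u -> M v -> M (u - v).
Proof.
have [L [_ LM]] := latM; move=> /LM [x ->] /LM [y ->]; apply/LM.
by exists (x - y); rewrite map_mxB mulmxBl.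
Qed.

Lemma lattice0 : M 0.
Proof. by have [L [_ LM]] := latM; apply/LM; exists 0; rewrite map_mx0 mul0mx. Qed.

Lemma latticeZ (z : int) (v : V) : M v -> M (z%:~R *: v).
Proof.
have [L [_ LM]] := latM; move=> /LM [x ->]; apply/LM; exists (z *: x).
by rewrite map_mxZ scalemxAl.
Qed.

(** For [v] in [M], the difference of [v] and its reflection is a multiple of [a] lying in [M]; it
    is nonzero for some basis vector, as [a] is not orthogonal to all of them. *)
Lemma lattice_refl_multiple (a : V) : a != 0 ->
  (forall v, M v -> M (reflmap B a v)) -> exists2 t : R, 0 < t & M (t *: a).
Proof.
move=> a0 Ms; have [L [Lu LM]] := latM.
have [i ai] : exists i, ip (row i L) a != 0.
  apply/existsP; apply: contraT => /existsPn Hno; have := ip_gt0 posB a0.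
  rewrite -{1}[a](mulmxKV Lu) mulmx_sum_row ip_suml big1 ?ltxx // => i _.
  by have /negPn/eqP ai := Hno i; rewrite ipZl ai mulr0.
have Mi : M (row i L).
  by apply/LM; exists (delta_mx 0 i); rewrite map_delta_mx rowE.
pose t := 2 * ip (row i L) a / ip a a.
have Mt : M (t *: a).
  by rewrite -[_ *: _](subKr (row i L)); apply: lattice_sub => //; apply: Ms.
have t0 : t != 0.
  by rewrite /t !mulf_neq0 ?invr_neq0 ?pnatr_eq0 // gt_eqF ?ip_gt0.
case/orP: (lt_total t0) => [lt0|gt0]; last by exists t.
exists (- t); first by rewrite oppr_gt0.
by rewrite scaleNr -sub0r; apply: lattice_sub => //; exact: lattice0.
Qed.

(* The coordinates of [t *: a] in a basis of [M] are integers, which gives a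
   measure of [t] along which the Euclidean algorithm descends. *)
Lemma lattice_primitive (a : V) : a != 0 -> (exists2 t : R, 0 < t & M (t *: a)) ->
  exists c : R, [/\ 0 < c, M (c *: a) &
    forall t, M (t *: a) -> exists z : int, t = z%:~R * c].
Proof.
move=> a0 [t t_gt0 Mt]; have [L [Lu LM]] := latM.
have [j aj] : exists j, (a *m invmx L) 0 j != 0.
  apply/existsP; apply: contraT => /existsPn Hno; case/negP: a0; apply/eqP.
  rewrite -[a](mulmxKV Lu); suff -> : a *m invmx L = 0 by rewrite mul0mx.
  by apply/rowP => j; rewrite [RHS]mxE; apply/eqP/negPn.
pose e := `|(a *m invmx L) 0 j|.
have e_gt0 : 0 < e by rewrite normr_gt0.
have Mnat u : 0 < u -> M (u *: a) -> u * e \is a Num.nat.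
  move=> u_gt0 /LM [z zE]; rewrite -[u](ger0_norm (ltW u_gt0)) /e -normrM.
  have -> : u * (a *m invmx L) 0 j = (z 0 j)%:~R.
    have := congr1 (fun x => (x *m invmx L) 0 j) zE.
    by rewrite -scalemxAl mulmxK // [LHS]mxE [RHS]mxE.
  by rewrite natr_norm_int.
have /natrP [N] := Mnat _ t_gt0 Mt; have [K] := ubnP N.
elim: K N t t_gt0 Mt => // K IH N t t_gt0 Mt; rewrite ltnS => leN tN.
case: (boolp.EM (forall u, M (u *: a) -> exists z : int, u = z%:~R * t)).
  by move=> Hall; exists t.
move=> /boolp.existsNP [u /boolp.not_implyP [Mu uN]].
(* The remainder of [u] modulo [t], nonzero since [u] is not an integral multiple of [t]. *)
pose v := u - (Num.floor (u / t))%:~R * t.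
have Mv : M (v *: a).
  by rewrite scalerBl -scalerA; apply: lattice_sub => //; apply: latticeZ.
have vE : v = (u / t - (Num.floor (u / t))%:~R) * t by rewrite mulrBl divfK ?gt_eqF.
have v_ge0 : 0 <= v by rewrite vE mulr_ge0 ?subr_ge0 ?floor_le // ltW.
have v_lt : v < t.
  rewrite vE -[ltRHS]mul1r ltr_pM2r // ltrBlDl.
  by have := floorD1_gt (u / t); rewrite intrD.
have v_gt0 : 0 < v.
  rewrite lt_neqAle v_ge0 andbT; apply/eqP => v0; apply: uN.
  by exists (Num.floor (u / t)); apply/eqP; rewrite -subr_eq0 -/v -v0.
have /natrP [N' N'E] := Mnat _ v_gt0 Mv.
apply: (IH N' v) => //; apply: leq_trans leN.
by rewrite -(ltr_nat R) -N'E -tN ltr_pM2r.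
Qed.

End Lattice.

Theorem theorem1p2 (R : realType) (n : nat) (B : 'M[R]_n)
    (M : 'rV[R]_n -> Prop) (W : seq 'M[R]_n) (Phi Delta : seq 'rV[R]_n)
    (S : 'rV[R]_n -> Prop) :
  posdef_sym B ->
  is_lattice M ->
  finite_reflection_group B W ->
  (forall w, w \in W -> maps_onto w M) ->
  root_system B Phi ->
  generated_by B W Phi ->
  simple_system Phi Delta ->
  saturated_affine_semigroup M S ->
  (forall w, w \in W -> maps_onto w S) ->
  exists phi : @Zring R n -> @Zring R n,
    ring_iso_between
      (supported_in (fun v => fund_domain B Delta v /\ S v))
      (fun f => supported_in S f /\ W_invariant W f)
      phi.
Proof.
move=> posB latM [groupW _] WM rootPhi [WPhi Wgen] [DeltaPhi freeD _ signD].
move=> [SM [gens Sgens] Ssat] WS.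
pose al (i : 'I_(size Delta)) := Delta`_i.
have alD i : al i \in Delta by apply: mem_nth.
have alPhi i : al i \in Phi by apply: DeltaPhi.
have al0 i : al i != 0 by have [] := rootPhi _ (alPhi i).
have [dl [dual dl_span]] : exists d : 'I_(size Delta) -> 'rV[R]_n,
    (forall i j, ip B (al i) (d j) = (i == j)%:R) /\
    forall j, exists c : 'I_(size Delta) -> R, d j = \sum_i c i *: al i.
  by apply: exists_dual => // c sum0;
    have /freeP := freeD : free (in_tuple Delta); apply.
have dual_coord (c : 'I_(size Delta) -> R) j : ip B (\sum_i c i *: al i) (dl j) = c j.
  rewrite ip_suml (bigD1 j) //= ipZl dual eqxx mulr1 big1 ?addr0 // => i /negPf ij.
  by rewrite ipZl dual ij mulr0.
have coordE b : b \in Phi -> b = \sum_j ip B b (dl j) *: al j.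
  by move=> /signD [c [bE _]];
    rewrite {1}bE; apply: eq_bigr => j _; rewrite bE dual_coord.
have signed b : b \in Phi ->
    (forall j, 0 <= ip B b (dl j)) \/ (forall j, ip B b (dl j) <= 0).
  by move=> /signD [c [-> [pos|neg]]]; [left|right] => j; rewrite dual_coord.
have Mrefl i v : M v -> M (reflmap B (al i) v).
  by rewrite -mul_refl_mx; have [+ _] := WM _ (WPhi _ (alPhi i)); apply.
have /fin_all_exists [c cP] i := lattice_primitive latM (al0 i)
  (lattice_refl_multiple posB latM (al0 i) (Mrefl i)).
have c_gt0 i : 0 < c i by have [] := cP i.
have c_neq0 i : c i != 0 by rewrite gt_eqF.
pose be i := c i *: al i.
have be0 i : be i != 0 by rewrite scaler_eq0 negb_or c_neq0 al0.
have beM i : M (be i) by have [] := cP i.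
have reflbe i v : reflmap B (be i) v = reflmap B (al i) v by rewrite reflZ.
have actbe l v : word_act B be l v = word_act B al l v.
  by elim: l v => //= i l IH v; rewrite -IH /word_act /= reflbe.
have Mint v i : M v -> coroot_pairing B (be i) v \is a Num.int.
  (* The vector [v - s v] is the coroot pairing times [be i] and lies in [M]; since [be i] generates
     the lattice points on its line, the factor is an integer. *)
  move=> Mv; have [_ _ /(_ (coroot_pairing B (be i) v * c i))] := cP i.
  case=> [|z /(mulIf (c_neq0 i)) ->]; last exact: intr_int.
  rewrite -scalerA -[_ *: _](subKr v); apply: lattice_sub => //.
  by rewrite -[v - _]/(reflmap B (be i) v) reflbe; apply: Mrefl.
(* The factor turns duality to the simple roots into duality to the coroots of the [be i]. *)
pose om i := ((c i)^-1 * ip B (be i) (be i) / 2) *: dl i.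
have omE i j : coroot_pairing B (be i) (om j) = (i == j)%:R.
  have dl_be : ip B (dl j) (be i) = c i * (i == j)%:R by rewrite ipC // ipZl dual.
  rewrite /coroot_pairing /om ipZl dl_be.
  have [->|_] := eqVneq i j; last by rewrite !mulr0 mul0r.
  have := ip_gt0 posB (be0 j); move: (ip B _ _) => q q_gt0.
  by field; rewrite c_neq0 gt_eqF.
pose rho := \sum_j (c j)^-1 *: dl j.
have ht_be i : ip B (be i) rho = 1.
  rewrite /rho ip_sumr // (bigD1 i) //= big1 ?addr0 => [|j /negPf ji].
    by rewrite ipZr // ipZl dual eqxx mulr1 mulVf.
  by rewrite ipZr // ipZl dual eq_sym ji !mulr0.
have rho_span : exists d : 'I_(size Delta) -> R, rho = \sum_i d i *: be i.
  have /fin_all_exists [d dE] := dl_span.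
  exists (fun i => \sum_j (c j)^-1 * d j i / c i).
  rewrite /rho; under eq_bigr do rewrite dE scaler_sumr.
  rewrite exchange_big; apply: eq_bigr => i _; rewrite scaler_suml.
  by apply: eq_bigr => j _; rewrite /be !scalerA divfK.
have Wrefl i : refl_mx B (be i) \in W.
  suff -> : refl_mx B (be i) = refl_mx B (al i) by apply: WPhi.
  by apply/row_matrixP => j; rewrite !rowE !mul_refl_mx reflbe.
have Wword w : w \in W -> exists l, forall v, v *m w = word_act B be l v.
  (* The given generators are reflections in arbitrary roots; each one is expanded into simple
     reflections. *)
  case/Wgen => l [lPhi ->]; elim: l lPhi => [|b l IH] lPhi.
    by exists [::] => v; rewrite mulmx1.
  have [l1 l1E] :=
    refl_simple_word posB rootPhi alPhi dual coordE signed (lPhi _ (mem_head _ _)).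
  have [|l2 l2E] := IH; first by move=> x xl; apply: lPhi; rewrite inE xl orbT.
  exists (l1 ++ l2) => v.
  by rewrite /= mulmxA mul_refl_mx l1E l2E !actbe /word_act foldl_cat.
have dom_be v i : (0 <= ip B v (be i)) = (0 <= ip B v (al i)).
  by rewrite ipZr // pmulr_rge0.
have word_step lam : (forall j, 0 <= ip B lam (be j)) -> forall l i,
    0 <= ip B (word_act B be l lam) (be i) \/
    exists l1, (size l1 < size l)%N /\
      forall v, reflmap B (be i) (word_act B be l v) = word_act B be l1 v.
  move=> dom l i; rewrite dom_be actbe.
  have [|ge0|[l1 [szl l1E]]] :=
    @dominant_word_step _ _ _ B posB Phi al dl rootPhi alPhi dual coordE signed lam l i.
  - by move=> j; rewrite -dom_be.
  - by left.
  - by right; exists l1; split=> // v; rewrite reflbe !actbe.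
have S0 : S 0.
  by apply/Sgens; exists (fun=> 0%N); rewrite big1 // => i _; rewrite scale0r.
have SD u v : S u -> S v -> S (u + v).
  move=> /Sgens [j ->] /Sgens [k ->]; apply/Sgens; exists (fun i => j i + k i)%N.
  by rewrite -big_split; apply: eq_bigr => i _; rewrite natrD scalerDl.
have SW w v : w \in W -> S v -> S (v *m w) by move=> /WS [+ _]; apply.
have -> : (fun v => fund_domain B Delta v /\ S v) =
    (fun v => (forall i, 0 <= ip B v (be i)) /\ S v).
  apply/boolp.funext => v; apply/boolp.propext; split=> -[dv Sv]; split=> //.
    by move=> i; rewrite dom_be; apply: dv.
  move=> a aD; have i_lt : (index a Delta < size Delta)%N by rewrite index_mem.
  by have := dv (Ordinal i_lt); rewrite dom_be /al /= nth_index.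
exists (extend (monomial B W be om)).
apply: (@extend_iso _ _ _ B posB W be om rho _ _ _ _ _ _ _ _ _ M S) => //.
- by move=> i j; apply: Mint.
- exact: lattice_sub.
Qed.
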